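(* Consider the network of $q\ge 2$ units $$\dot x_i=Ax_i+\mu\sum_{k=1}^{\infty}\delta(t-kT)\,BK\Big(\sum_{j=1}^{q}\gamma_{ij}(x_j-x_i)\Big),\qquad i=1,\dots,q,$$ with $x_i\in\mathbb{R}^n$, $A\in\mathbb{R}^{n\times n}$, $B\in\mathbb{R}^{n\times 1}$, $K\in\mathbb{R}^{1\times n}$, $T>0$, weights $\gamma_{ij}\ge 0$ ($\gamma_{ii}=0$) and Laplacian $\Gamma\in\mathbb{R}^{q\times q}$. Assume that $(A,B)$ and $(e^{AT},B)$ are controllable pairs, that the directed graph of the network contains a spanning tree (equivalently, $\Gamma$ has a simple eigenvalue at $0$ and its other $q-1$ eigenvalues have strictly positive real parts), and that $$\left[(I-BK)e^{AT}\right]^n=0 .$$ Suppose $\mu=\infty$ (in the limiting sense specified in the context). Then the solutions satisfy $x_i(t)=x_j(t)$ for all pairs $(i,j)$ and all $t>nT$.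
   Context: The Laplacian is $\Gamma\in\mathbb{R}^{q\times q}$ with off-diagonal entries $\Gamma_{ij}=-\gamma_{ij}$ ($i\ne j$) and diagonal entries $\Gamma_{ii}=\sum_{j}\gamma_{ij}$. $\otimes$ is the Kronecker product and $I$ is the identity matrix of the appropriate size. Meaning of the impulsive dynamics ($\delta$ is the Dirac delta): write $x=[x_1^\top\ \cdots\ x_q^\top]^\top\in\mathbb{R}^{qn}$ and let $x(0)$ be the (arbitrary) initial condition. For finite $\mu>0$, a solution satisfies $\dot x(t)=[I\otimes A]x(t)$ for $t\ge 0$, $t\ne kT$ ($k=1,2,\dots$), and at each time $kT$, $k=1,2,\dots$, it jumps according to $x(kT^+)=e^{-\mu[\Gamma\otimes BK]}x(kT^-)$, where $x(kT^{\pm})$ are the one-sided limits. The case $\mu=\infty$ means that the same flow is used between impulses, and the jump matrix is replaced by its limit: $x(kT^+)=\Big(\lim_{\mu\to\infty}e^{-\mu[\Gamma\otimes BK]}\Big)x(kT^-)$. The value at the impulse times can be taken to be $x(kT^+)$. *)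

(* Defs.v *)
From HB Require Import structures.
From mathcomp Require Import all_boot all_order all_algebra.
From mathcomp Require Import mxtens.
From mathcomp Require Import all_classical all_reals all_analysis.

Set Implicit Arguments.
Unset Strict Implicit.
Unset Printing Implicit Defensive.

Import Order.TTheory GRing.Theory Num.Theory.
Import numFieldNormedType.Exports.

Local Open Scope classical_set_scope.
Local Open Scope ring_scope.

Definition expm (R : realType) (d : nat) (M : 'M[R]_d) : 'M[R]_d :=
  limn (series (fun k : nat => (k`!%:R)^-1 *: M ^+ k)).

(* Full rank of the block row [B, F B, ..., F^(n-1) B]; it is used both for
   continuous-time pairs (A, B) and for discrete-time pairs (e^(AT), B). *)
Definition controllable (R : realType) (n m : nat)
    (F : 'M[R]_n) (B : 'M[R]_(n, m)) : Prop :=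
  \rank (\mxrow_(k < n) (F ^+ k *m B)) = n.

Definition laplacian (R : realType) (q : nat) (gamma : 'M[R]_q) : 'M[R]_q :=
  \matrix_(i, j) if i == j then \sum_k gamma i k else - gamma i j.

(* gamma i j is the weight with which unit i listens to unit j, so it is
   carried by the edge j -> i, and a spanning tree grows away from its root in
   the direction in which information flows. *)
Definition edge (R : realType) (q : nat) (gamma : 'M[R]_q) : rel 'I_q :=
  fun j i => 0 < gamma i j.

Definition rooted_tree (q : nat) (E : rel 'I_q) (r : 'I_q) : Prop :=
  (forall i, connect E r i) /\
  (forall i, #|[set j | E j i]%SET| = if i == r then 0%N else 1%N).

Definition has_spanning_tree (q : nat) (e : rel 'I_q) : Prop :=
  exists E r, subrel E e /\ rooted_tree E r.

(* Stacked states live in R^(q * n); mxtens_index (i, k) is i * n + k. *)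
Definition unit_state (R : realType) (q n : nat)
    (x : 'cV[R]_(q * n)) (i : 'I_q) : 'cV[R]_n :=
  \col_k x (mxtens_index (i, k)) ord0.

(* e^(- mu (Gamma (x) BK)), the jump at an impulse of finite strength mu, and
   its limit as mu tends to +oo (meaningful only when the limit exists). *)
Definition jump (R : realType) (q n : nat) (gamma : 'M[R]_q)
    (B : 'cV[R]_n) (K : 'rV[R]_n) (mu : R) : 'M[R]_(q * n) :=
  expm (- (mu *: (laplacian gamma *t (B *m K)))).

Definition jump_infty (R : realType) (q n : nat) (gamma : 'M[R]_q)
    (B : 'cV[R]_n) (K : 'rV[R]_n) : 'M[R]_(q * n) :=
  lim (jump gamma B K mu @[mu --> +oo]).

(* Only the values of x on [0, +oo[ are constrained: the derivative at 0 is
   one-sided, and x is right-continuous at the impulse times. *)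
Definition impulsive_solution (R : realType) (q n : nat) (A : 'M[R]_n) (T : R)
    (J : 'M[R]_(q * n)) (x : R -> 'cV[R]_(q * n)) : Prop :=
  [/\ h^-1 *: (x h - x 0) @[h --> 0^'+] --> (1%:M *t A) *m x 0,
      forall t : R, 0 < t -> (forall k : nat, (0 < k)%N -> t != k%:R * T) ->
        is_derive t (1 : R) x ((1%:M *t A) *m x t)
    & forall k : nat, (0 < k)%N ->
        exists xm : 'cV[R]_(q * n),
          [/\ x t @[t --> (k%:R * T)^'-] --> xm,
              x t @[t --> (k%:R * T)^'+] --> J *m xm
            & x (k%:R * T) = J *m xm]].

(* Main.v *)
Require Import Defs.
From HB Require Import structures.
From mathcomp Require Import all_boot all_order all_algebra.
From mathcomp Require Import mxtens.
From mathcomp Require Import all_classical all_reals all_analysis.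
From mathcomp Require Import ring lra.
Set Implicit Arguments.
Unset Strict Implicit.
Unset Printing Implicit Defensive.

Import Order.TTheory GRing.Theory Num.Theory.
Import numFieldNormedType.Exports.
Local Open Scope classical_set_scope.
Local Open Scope ring_scope.

(* Since e^(AT) is invertible, nilpotency makes I - BK singular, which for the
   rank-one BK means KB = 1; so P = BK is a projection and the jump is
   I (x) (I - P) + e^(- mu Gamma) (x) P.  The matrices e^(- t Gamma), t >= 0,
   form a semigroup of stochastic matrices, and the spanning tree makes the column of
   its root in e^(- Gamma) positive.  Doeblin's contraction argument then gives
   a limit L of e^(- t Gamma) all of whose rows are equal.  Hence L (x) P
   contributes nothing to a difference x_i - x_j, which is multiplied by
   (I - P) e^(AT) over each period and vanishes after n of them. *)

(** * Entrywise limits and derivatives of matrix-valued functions *)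

Lemma cvg_mxP (R : realType) (m n : nat) (I : Type) (F : set_system I)
    (f : I -> 'M[R]_(m, n)) (L : 'M[R]_(m, n)) {FF : Filter F} :
  f x @[x --> F] --> L <-> forall i j, f x i j @[x --> F] --> L i j.
Proof.
split=> [fL i j|fL].
  exact: (cvg_comp _ _ fL (@coord_continuous _ _ _ i j L)).
apply/cvgrPdist_le => e e0; near=> x.
(* The norm is the largest absolute value of an entry, and finitely many eventual bounds hold
   together eventually. *)
rewrite /Num.Def.normr/= mx_normrE (bigmax_le _ (ltW e0))//= => ij _.
rewrite !mxE/=.
move: ij; near: x; apply: filter_forall => /= ij.
exact: ((cvgrPdist_le _ _).1 (fL ij.1 ij.2)).
Unshelve. all: by end_near. Qed.

Lemma cvg_mulmx (R : realType) (m n p : nat) (I : Type) (F : set_system I)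
    (f : I -> 'M[R]_(m, n)) (g : I -> 'M[R]_(n, p))
    (a : 'M[R]_(m, n)) (b : 'M[R]_(n, p)) {FF : Filter F} :
  f x @[x --> F] --> a -> g x @[x --> F] --> b ->
  f x *m g x @[x --> F] --> a *m b.
Proof.
move=> /cvg_mxP fa /cvg_mxP gb; apply/cvg_mxP => i j.
rewrite mxE.
have -> : (fun x => (f x *m g x) i j) = \sum_k (fun x => f x i k * g x k j).
  by apply/funext => x; rewrite mxE fct_sumE.
apply: (big_ind2 (fun u l => u x @[x --> F] --> l)) => [|u l v l' ul vl'|k _].
- exact: cvg_cst.
- exact: cvgD.
- by apply: cvgM; [exact: fa|exact: gb].
Qed.

Lemma is_derive_mxP (R : realType) (m n : nat) (f : R -> 'M[R]_(m, n))
    (t : R) (D : 'M[R]_(m, n)) :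
  is_derive t 1 f D <-> forall i j, is_derive t 1 (fun s => f s i j) (D i j).
Proof.
split=> [[df Df] i j|H].
  apply: DeriveDef; first by move/derivable_mxP: df; exact.
  by rewrite -Df derive_mx// mxE.
have df : derivable f t 1 by apply/derivable_mxP => i j; case: (H i j).
apply: DeriveDef => //; rewrite derive_mx//; apply/matrixP => i j.
by rewrite mxE; case: (H i j).
Qed.

Lemma is_derive_mulmx (R : realType) (m n p : nat) (f : R -> 'M[R]_(m, n))
    (g : R -> 'M[R]_(n, p)) (t : R) Df Dg :
  is_derive t 1 f Df -> is_derive t 1 g Dg ->
  is_derive t 1 (fun s => f s *m g s) (Df *m g t + f t *m Dg).
Proof.
move=> /is_derive_mxP df /is_derive_mxP dg; apply/is_derive_mxP => i j.
have -> : (fun s => (f s *m g s) i j) =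
    \sum_(k < n) ((fun s => f s i k) * (fun s => g s k j)).
  by apply/funext => s; rewrite mxE fct_sumE.
have dk k := @is_deriveM _ _ _ _ _ _ _ _ (df i k) (dg k j).
have ? := @is_derive_sum _ _ _ _ _ _ _ _ dk.
apply: is_derive_eq; rewrite !mxE -big_split/=; apply: eq_bigr => k _.
by rewrite addrC /GRing.scale/= [g t k j * _]mulrC.
Qed.

Lemma is_derive_mx_cst (R : realType) (m n : nat) (C : 'M[R]_(m, n)) (t : R) :
  is_derive t 1 (fun _ : R => C) 0.
Proof. exact: is_derive_cst. Qed.

Lemma is_derive_mx_cvg (R : realType) (m n : nat) (f : R -> 'M[R]_(m, n))
    (t : R) (D : 'M[R]_(m, n)) :
  is_derive t 1 f D -> f s @[s --> t] --> f t.
Proof. by case=> df _; exact/differentiable_continuous/derivable1_diffP. Qed.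

(** The mean value theorem applied to each entry. Only one-sided continuity is asked at the
    endpoints, because solutions jump at impulse times. *)
Lemma derive0_itv_cst (R : realType) (m n : nat) (f : R -> 'M[R]_(m, n))
    (a b : R) : a < b ->
  (forall t, a < t < b -> is_derive t 1 f 0) ->
  f t @[t --> a^'+] --> f a -> f t @[t --> b^'-] --> f b -> f b = f a.
Proof.
move=> ab df /cvg_mxP fa /cvg_mxP fb; apply/matrixP => i j.
have dij t : t \in `]a, b[ -> is_derive t 1 (fun s => f s i j) (cst 0 t).
  rewrite in_itv/= => /df /is_derive_mxP /(_ i j).
  by rewrite mxE.
have [|c _] := @MVT _ (fun s => f s i j) (cst 0) a b ab dij.
  apply/(continuous_within_itvP _ ab); split; [|exact: fa|exact: fb].
  move=> t /dij [dt _]; exact/differentiable_continuous/derivable1_diffP.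
by rewrite mul0r => /eqP; rewrite subr_eq0 => /eqP.
Qed.

(** * The matrix exponential as a power series *)

Lemma cvg_pseries_fact (R : realType) (c : nat -> R) (C r x : R) :
  (forall k, `|c k| <= C * r ^+ k) ->
  cvgn (pseries (fun k => (k`!%:R)^-1 * c k) x).
Proof.
move=> cC; apply: normed_cvg.
have expE k : (C *: exp_coeff (r * `|x|)) k = C * r ^+ k * `|x| ^+ k / k`!%:R.
  by rewrite fctE /exp_coeff/= /GRing.scale/= exprMn !mulrA.
(* Domination by [C] times the scalar exponential series at [r * |x|]. *)
apply: (@series_le_cvg _ _ (C *: exp_coeff (r * `|x|))).
- by move=> k /=; rewrite normr_ge0.
- move=> k; rewrite expE divr_ge0 ?ler0n// mulr_ge0 ?exprn_ge0//.
  exact: le_trans (cC k).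
- move=> k; rewrite expE /= !normrM normfV normr_nat normrX -mulrA mulrC.
  by rewrite ler_wpM2r ?invr_ge0 ?ler0n// ler_wpM2r ?exprn_ge0.
- apply: is_cvg_seriesZ; exact: is_cvg_series_exp_coeff.
Qed.

Lemma mxexprS (R : realType) (d : nat) (M : 'M[R]_d) k :
  M ^+ k.+1 = M *m M ^+ k.
Proof. by rewrite exprS. Qed.

Lemma mxexprZ (R : realType) (d : nat) (t : R) (M : 'M[R]_d) k :
  (t *: M) ^+ k = t ^+ k *: M ^+ k.
Proof.
elim: k => [|k IH]; first by rewrite !expr0 scale1r.
by rewrite !mxexprS IH -scalemxAl -scalemxAr scalerA exprS.
Qed.

(** The maximum norm is not submultiplicative: each further product sums [d] terms, which accounts
    for the factor [d%:R]. *)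
Lemma ler_mxexpr_coord (R : realType) (d : nat) (M : 'M[R]_d) k i j :
  `|(M ^+ k) i j| <= (d%:R * `|M|) ^+ k.
Proof.
elim: k i j => [|k IH] i j.
  rewrite !expr0 mxE; case: (_ == _); rewrite ?mulr1n ?mulr0n ?normr1 ?normr0//.
rewrite mxexprS mxE (le_trans (ler_norm_sum _ _ _))//.
have -> : (d%:R * `|M|) ^+ k.+1 = \sum_(l < d) `|M| * (d%:R * `|M|) ^+ k.
  by rewrite sumr_const card_ord -[RHS]mulr_natl exprS mulrA.
apply: ler_sum => l _; rewrite normrM ler_pM//.
rewrite [leRHS]/Num.Def.normr/= mx_normrE.
exact: (le_bigmax _ (fun ij : 'I_d * 'I_d => `|M ij.1 ij.2|) (i, l)).
Qed.

(** The shift [p] covers the series of successive derivatives: differentiating termwise turns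
    [M ^+ k] into [M ^+ k.+1] over the same factorial. *)
Lemma cvg_pseries_mx_coord (R : realType) (d p : nat) (M : 'M[R]_d) (t : R)
    i j :
  cvgn (pseries (fun k => (k`!%:R)^-1 * (M ^+ (k + p)) i j) t).
Proof.
apply: (@cvg_pseries_fact _ _ ((d%:R * `|M|) ^+ p) (d%:R * `|M|)) => k.
by rewrite -exprD addnC; exact: ler_mxexpr_coord.
Qed.

Lemma cvg_expm (R : realType) (d : nat) (M : 'M[R]_d) :
  series (fun k => (k`!%:R)^-1 *: M ^+ k) n @[n --> \oo] --> expm M.
Proof.
apply/cvg_ex; exists (\matrix_(i, j)
  limn (pseries (fun k => (k`!%:R)^-1 * (M ^+ (k + 0)) i j) 1)).
apply/cvg_mxP => i j; rewrite mxE.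
rewrite [X in X @ _](_ : _ =
  pseries (fun k => (k`!%:R)^-1 * (M ^+ (k + 0)) i j) 1).
  exact: cvg_pseries_mx_coord.
apply/funext => k; rewrite /pseries /series/= summxE; apply: eq_bigr => l _.
by rewrite mxE expr1n mulr1 addn0.
Qed.

Lemma expm_coordE (R : realType) (d : nat) (M : 'M[R]_d) (t : R) i j :
  expm (t *: M) i j = limn (pseries (fun k => (k`!%:R)^-1 * (M ^+ k) i j) t).
Proof.
apply/esym/cvg_lim; first exact: norm_hausdorff.
have /cvg_mxP /(_ i j) := @cvg_expm _ _ (t *: M).
rewrite [X in X @ _](_ : _ = pseries (fun k => (k`!%:R)^-1 * (M ^+ k) i j) t)//.
apply/funext => k; rewrite /pseries /series/= summxE; apply: eq_bigr => l _.
by rewrite mxE mxexprZ mxE mulrCA mulrC.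
Qed.

Lemma mulmx_expm_coordE (R : realType) (d : nat) (M : 'M[R]_d) (t : R) i j :
  (M *m expm (t *: M)) i j =
  limn (pseries (fun k => (k`!%:R)^-1 * (M ^+ k.+1) i j) t).
Proof.
apply/esym/cvg_lim; first exact: norm_hausdorff.
have : M *m series (fun k => (k`!%:R)^-1 *: (t *: M) ^+ k) n @[n --> \oo] -->
    M *m expm (t *: M).
  by apply: cvg_mulmx; [exact: cvg_cst|exact: cvg_expm].
move=> /cvg_mxP /(_ i j).
rewrite [X in X @ _](_ : _ =
  pseries (fun k => (k`!%:R)^-1 * (M ^+ k.+1) i j) t)//.
apply/funext => k; rewrite /pseries /series/= mulmx_sumr summxE.
apply: eq_bigr => l _.
by rewrite mxexprZ -!scalemxAr -mxexprS !mxE mulrCA mulrC.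
Qed.

Lemma expm_mulmx_coordE (R : realType) (d : nat) (M : 'M[R]_d) (t : R) i j :
  (expm (t *: M) *m M) i j =
  limn (pseries (fun k => (k`!%:R)^-1 * (M ^+ k.+1) i j) t).
Proof.
apply/esym/cvg_lim; first exact: norm_hausdorff.
have : series (fun k => (k`!%:R)^-1 *: (t *: M) ^+ k) n *m M @[n --> \oo] -->
    expm (t *: M) *m M.
  by apply: cvg_mulmx; [exact: cvg_expm|exact: cvg_cst].
move=> /cvg_mxP /(_ i j).
rewrite [X in X @ _](_ : _ =
  pseries (fun k => (k`!%:R)^-1 * (M ^+ k.+1) i j) t)//.
apply/funext => k; rewrite /pseries /series/= mulmx_suml summxE.
apply: eq_bigr => l _.
rewrite mxexprZ -!scalemxAl -[M ^+ l *m M]/(M ^+ l * M) -exprSr !mxE.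
by rewrite mulrCA mulrC.
Qed.

Lemma expm_comm (R : realType) (d : nat) (M : 'M[R]_d) (t : R) :
  expm (t *: M) *m M = M *m expm (t *: M).
Proof.
by apply/matrixP => i j; rewrite expm_mulmx_coordE mulmx_expm_coordE.
Qed.

Lemma is_derive_expm (R : realType) (d : nat) (M : 'M[R]_d) (t : R) :
  is_derive t 1 (fun s => expm (s *: M)) (M *m expm (t *: M)).
Proof.
apply/is_derive_mxP => i j; rewrite mulmx_expm_coordE.
have diffE p : pseries_diffs (fun k => (k`!%:R)^-1 * (M ^+ (k + p)) i j) =
    (fun k => (k`!%:R)^-1 * (M ^+ (k + p.+1)) i j).
  apply/funext => k; rewrite /pseries_diffs factS natrM invfM.
  by rewrite !mulrA divff ?pnatr_eq0// mul1r addSnnS.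
under eq_fun do rewrite expm_coordE.
(* Termwise differentiation needs convergence of the series and of its first two formal derivatives
   ([p] = 0, 1, 2) at some point of modulus larger than [|t|], here [|t| + 1]. *)
have := @pseries_snd_diffs R (fun k => (k`!%:R)^-1 * (M ^+ (k + 0)) i j)
  (`|t| + 1) t.
rewrite !diffE => /(_ (@cvg_pseries_mx_coord _ _ _ _ _ _ _)
  (@cvg_pseries_mx_coord _ _ _ _ _ _ _) (@cvg_pseries_mx_coord _ _ _ _ _ _ _)).
under eq_fun do under eq_fun do rewrite addn0.
under [X in limn (pseries X t)]eq_fun do rewrite addn1.
by apply; rewrite [ltRHS]ger0_norm ?addr_ge0// ltrDl.
Qed.

Lemma expm0 (R : realType) (d : nat) : expm (0 : 'M[R]_d) = 1%:M.
Proof.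
apply: lim_near_cst; first exact: norm_hausdorff.
near=> n; rewrite /series/=.
have n0 : (0 < n)%N by near: n; exact: nbhs_infty_gt.
rewrite -(prednK n0) big_nat_recl//= expr0 fact0 invr1 scale1r big1 ?addr0//.
by move=> k _; rewrite mxexprS mul0mx scaler0.
Unshelve. all: by end_near. Qed.

(** * Linear differential equations and the semigroup law *)

Lemma linear_ode_itv (R : realType) (d m : nat) (M : 'M[R]_d)
    (z : R -> 'M[R]_(d, m)) (a b : R) : a <= b ->
  (forall t : R, a < t < b -> is_derive t 1 z (M *m z t)) ->
  z t @[t --> a^'+] --> z a -> z t @[t --> b^'-] --> z b ->
  z b = expm ((b - a) *: M) *m z a.
Proof.
rewrite le_eqVlt => /predU1P[->|ab] dz za zb.
  by rewrite subrr scale0r expm0 mul1mx.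
(* [t |-> e^((b - t) M) z t] is constant *)
pose E (t : R) := expm ((t - b) *: - M).
(* With the factor [t - b] in front of [- M], the chain rule below has inner derivative 1. *)
have EE t : E t = expm ((b - t) *: M) by rewrite /E scalerN -scaleNr opprB.
have dE (t : R) : is_derive t 1 E (- M *m E t).
  have H := is_derive_expm (- M).
  apply/is_derive_mxP => i j.
  have /is_derive_mxP /(_ i j) h := H (t - b).
  have sub : is_derive t 1 (fun s : R => s - b) (1 : R).
    by apply: is_derive_eq; rewrite subr0.
  have := @is_derive1_comp _ (fun s => expm (s *: - M) i j) (fun s => s - b) t
    _ _ h sub.
  by rewrite mulr1.
have EM t : E t *m M = M *m E t by rewrite EE expm_comm.
have cE (t : R) : E s @[s --> t] --> E t by exact: is_derive_mx_cvg (dE t).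
have := @derive0_itv_cst _ _ _ (fun t => E t *m z t) a b ab.
rewrite /= !EE subrr scale0r expm0 mul1mx; apply.
- move=> t /dz dzt; have := is_derive_mulmx (dE t) dzt.
  by rewrite mulmxA EM mulNmx mulNmx addNr.
- rewrite -EE; apply: cvg_mulmx => //; apply: cvg_within_filter; exact: cE.
- rewrite -[z b in X in _ --> X]mul1mx -(expm0 R d) -(scale0r M) -(subrr b) -EE.
  by apply: cvg_mulmx => //; apply: cvg_within_filter; exact: cE.
Qed.

(** Serves as a uniqueness principle: a formula for an exponential is obtained by checking that it
    solves the equation and has the right value at 0. *)
Lemma linear_ode (R : realType) (d m : nat) (M : 'M[R]_d)
    (z : R -> 'M[R]_(d, m)) :
  (forall t : R, is_derive t 1 z (M *m z t)) ->
  forall t, 0 <= t -> z t = expm (t *: M) *m z 0.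
Proof.
move=> dz t t0; have cz s := is_derive_mx_cvg (dz s).
rewrite -[X in expm (X *: _)](subr0 t); apply: linear_ode_itv => //.
- exact: cvg_within_filter (cz _).
- exact: cvg_within_filter (cz _).
Qed.

Lemma expmD (R : realType) (d : nat) (M : 'M[R]_d) (t s : R) : 0 <= t ->
  expm ((t + s) *: M) = expm (t *: M) *m expm (s *: M).
Proof.
move=> t0; have := @linear_ode _ _ _ M (fun u => expm ((u + s) *: M)) _ t t0.
rewrite add0r; apply=> u; apply/is_derive_mxP => i j.
have /is_derive_mxP /(_ i j) dM := is_derive_expm M (u + s).
have du : is_derive u 1 (fun v : R => v + s) (1 : R).
  by apply: is_derive_eq; rewrite addr0.
have := @is_derive1_comp _ (fun v => expm (v *: M) i j) (fun v => v + s) u _ _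
  dM du.
by rewrite mulr1.
Qed.

Lemma expm_unitmx (R : realType) (d : nat) (M : 'M[R]_d) : expm M \in unitmx.
Proof.
have := expmD M (-1) (@ler01 R).
(* The semigroup law at times 1 and -1 exhibits the inverse. *)
rewrite subrr scale0r expm0 scale1r => /esym/mulmx1_unit; by case.
Qed.

(** * Positivity of exponentials of nonnegative matrices *)

Lemma mxexpr_ge0 (R : realType) (d : nat) (N : 'M[R]_d) k i j :
  (forall i j, 0 <= N i j) -> 0 <= (N ^+ k) i j.
Proof.
move=> N0; elim: k i j => [|k IH] i j; first by rewrite expr0 mxE ler0n.
by rewrite mxexprS mxE sumr_ge0// => l _; rewrite mulr_ge0.
Qed.

(** All terms of the series are nonnegative, so every partial sum past [k] dominates its term of
    index [k]. *)
Lemma ler_expm_coord (R : realType) (d : nat) (N : 'M[R]_d) k i j :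
  (forall i j, 0 <= N i j) -> (k`!%:R)^-1 * (N ^+ k) i j <= expm N i j.
Proof.
move=> N0; have /cvg_mxP /(_ i j) cN := @cvg_expm _ _ N.
apply: (cvgr_to_ge cN); near=> n.
have kn : (k < n)%N by near: n; exact: nbhs_infty_gt.
rewrite /series/= summxE big_mkord (bigD1 (Ordinal kn))//= mxE lerDl sumr_ge0//.
by move=> l _; rewrite mxE mulr_ge0 ?invr_ge0 ?ler0n ?mxexpr_ge0.
Unshelve. all: by end_near. Qed.

Lemma expm_ge0 (R : realType) (d : nat) (N : 'M[R]_d) i j :
  (forall i j, 0 <= N i j) -> 0 <= expm N i j.
Proof.
move=> N0; apply: le_trans (ler_expm_coord 0 i j N0).
by rewrite mulr_ge0 ?mxexpr_ge0 ?invr_ge0.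
Qed.

(** The exponent is the length of a path from [r] to [i]. An edge from [j] to [i] is the entry at
    row [i] and column [j], so appending an edge multiplies by [N] on the left. *)
Lemma mxexpr_path_gt0 (R : realType) (d : nat) (N : 'M[R]_d) (e : rel 'I_d)
    r i :
  (forall i j, 0 <= N i j) -> (forall j i, e j i -> 0 < N i j) ->
  connect e r i -> exists k, 0 < (N ^+ k) i r.
Proof.
move=> N0 eN /connectP[p pp ->] {i}; elim/last_ind: p pp => [|p i IH] /=.
  by exists 0%N; rewrite expr0 mxE eqxx.
rewrite rcons_path last_rcons => /andP[/IH[k Nk] /eN eli].
exists k.+1; rewrite mxexprS mxE (bigD1 (last r p))//= ltr_pwDl ?mulr_gt0//.
by apply: sumr_ge0 => l _; rewrite mulr_ge0 ?mxexpr_ge0.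
Qed.

(** Used to trade minus the Laplacian, whose diagonal is nonpositive, for a nonnegative matrix, at
    the price of a positive scalar factor. *)
Lemma expm_shift (R : realType) (d : nat) (M : 'M[R]_d) (c t : R) : 0 <= t ->
  expm (t *: (M - c%:M)) = expR (t * - c) *: expm (t *: M).
Proof.
move=> t0; have := @linear_ode _ _ _ (M - c%:M)
  (fun s => expR (s * - c) *: expm (s *: M)) _ t t0.
rewrite mul0r expR0 !scale0r expm0 scale1r mulmx1 => H.
apply/esym/H => s {H}.
apply/is_derive_mxP => i j; under eq_fun do rewrite mxE.
have /is_derive_mxP /(_ i j) dM := is_derive_expm M s.
have dc : is_derive s 1 (fun v : R => v * - c) (- c).
  have -> : (fun v : R => v * - c) = (- c) *: id.
    by apply/funext => v; rewrite fctE /GRing.scale/= mulrC.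
  by apply: is_derive_eq; rewrite /GRing.scale/= mulr1.
have de := @is_derive1_comp _ expR (fun v => v * - c) s
  _ _ (is_derive_expR _) dc.
have [dP DP] := @is_deriveM _ _ _ _ _ _ _ _ de dM.
apply: DeriveDef; first exact: dP.
rewrite [LHS]DP mulmxBl mul_scalar_mx -scalemxAr !mxE /GRing.scale/=.
ring.
Qed.

(** * Doeblin contraction for stochastic semigroups *)

(* The entries of [S *m v] are pulled towards the common value [v r 0]; with
   [a = 0] this is just the averaging property of a stochastic matrix. *)
Lemma doeblin_step (R : realType) (d : nat) (S : 'M[R]_d) (v : 'cV[R]_d) r
    (a m M : R) :
  (forall i j, 0 <= S i j) -> S *m const_mx 1 = const_mx 1 :> 'cV[R]_d ->
  (forall i, a <= S i r) -> (forall i, m <= v i 0 <= M) ->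
  forall i, m + a * (v r 0 - m) <= (S *m v) i 0 <= M - a * (M - v r 0).
Proof.
move=> S0 S1 Sr vb i.
have Sc (c : R) : \sum_j S i j * c = c.
  have /matrixP/(_ i 0) := S1; rewrite !mxE => S1i.
  rewrite -[RHS]mul1r -S1i -mulr_suml; congr (_ * _).
  by apply: eq_bigr => j _; rewrite mxE mulr1.
have mv j : m <= v j 0 by case/andP: (vb j).
have vM j : v j 0 <= M by case/andP: (vb j).
rewrite mxE; apply/andP; split.
(* Since the row sums to 1, subtracting [m] leaves a sum of nonnegative terms, of which only the one
   at [r] is kept. *)
- rewrite -[X in X + _ <= _](Sc m) -lerBrDl -sumrB (bigD1 r)//=.
  rewrite -mulrBr ler_wpDr//.
    by apply: sumr_ge0 => j _; rewrite -mulrBr mulr_ge0// subr_ge0.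
  by rewrite ler_wpM2r// subr_ge0.
- rewrite -[X in _ <= X - _](Sc M) lerBrDr -lerBrDl -sumrB (bigD1 r)//= -mulrBr.
  rewrite ler_wpDr//.
    by apply: sumr_ge0 => j _; rewrite -mulrBr mulr_ge0// subr_ge0.
  by rewrite ler_wpM2r// subr_ge0.
Qed.

(** An interval enclosing column [j] remains valid at later times and can be shrunk by the factor
    [1 - a] per unit of time, so all entries of the column are squeezed to one limit. *)
Lemma stochastic_semigroup_cvg (R : realType) (d : nat) (U : R -> 'M[R]_d)
    (r : 'I_d) (a : R) :
  (forall t i j, 0 <= t -> 0 <= U t i j) ->
  (forall t, 0 <= t -> U t *m const_mx 1 = const_mx 1 :> 'cV[R]_d) ->
  (forall s t, 0 <= s -> 0 <= t -> U (s + t) = U s *m U t) -> U 0 = 1%:M ->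
  0 < a -> (forall i, a <= U 1 i r) ->
  exists l : 'I_d -> R, forall i j, U t i j @[t --> +oo] --> l j.
Proof.
move=> U0 U1 UD Uid a0 Ur.
(* Taking [b = 0] gives persistence of the bounds ([later]); taking [t = 1] and [b = a] gives the
   contraction ([osc]). *)
have step t s b m M j : 0 <= t -> 0 <= s -> (forall i, b <= U t i r) ->
    (forall i, m <= U s i j <= M) ->
    forall i, m + b * (U s r j - m) <= U (t + s) i j <= M - b * (M - U s r j).
  move=> t0 s0 Ub sb i.
  have E : U (t + s) i j = (U t *m col j (U s)) i 0.
    by rewrite UD// !mxE; apply: eq_bigr => l _; rewrite mxE.
  have := @doeblin_step _ _ (U t) (col j (U s)) r b m M _ (U1 t t0) Ub _ i.
  by rewrite mxE -E; apply=> [i' j'|i']; [exact: U0|rewrite mxE].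
have later t s m M j : 0 <= s -> s <= t -> (forall i, m <= U s i j <= M) ->
    forall i, m <= U t i j <= M.
  move=> s0 st sb i; have := @step (t - s) s 0 m M j.
  rewrite subrK !mul0r addr0 subr0; apply=> // [|i']; first by rewrite subr_ge0.
  by rewrite U0// subr_ge0.
have U01 i j : 0 <= U 0 i j <= 1.
  by rewrite Uid mxE; case: (i == j); rewrite ?lexx ?ler01.
(* Together with [0 < a] this gives [|1 - a| < 1], so the widths tend to 0. *)
have a1 : a <= 1.
  apply: le_trans (Ur r) _.
  by have /andP[] := @later 1 0 0 1 r (lexx _) ler01 (U01^~ r) r.
have osc j k : exists m M, M - m = (1 - a) ^+ k /\
    forall i t, k%:R <= t -> m <= U t i j <= M.
  suff [m [M [mM mUM]]] : exists m M, M - m = (1 - a) ^+ k /\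
      forall i, m <= U k%:R i j <= M.
    by exists m, M; split=> // i t kt; apply: (later t k%:R).
  elim: k => [|k [m [M [mM mUM]]]].
    by exists 0, 1; rewrite subr0 expr0.
  (* The new width is [(1 - a) * (M - m)]: the value in row [r] cancels. *)
  exists (m + a * (U k%:R r j - m)), (M - a * (M - U k%:R r j)); split.
    by rewrite exprS -mM; ring.
  by move=> i; rewrite -natr1 [_ + 1]addrC; apply: step.
have small j e : 0 < e -> exists k m M, M - m < e /\
    forall i t, k%:R <= t -> m <= U t i j <= M.
  move=> e0; have : `|1 - a| < 1 by rewrite ger0_norm ?subr_ge0// ltrBlDr ltrDl.
  move=> /cvg_expr/cvgrPdist_lt /(_ e e0) [k _ /(_ k (leqnn k))].
  have [m [M [mM mUM]]] := osc j k.
  rewrite /= -mM sub0r normrN => /(le_lt_trans (ler_norm _)) Mm.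
  by exists k, m, M.
have ev k : \forall t \near +oo, (k%:R : R) <= t.
  by apply: nbhs_pinfty_ge; exact: num_real.
(* Row [r] is a Cauchy reference; any other row lies in the same shrinking intervals, hence has the
   same limit. *)
have cU j : cvg (U t r j @[t --> +oo]).
  apply/cauchy_cvgP/cauchy_exP => e /(small j)[k [m [M [Mm mUM]]]]; exists m.
  apply: filterS (ev k) => t /(mUM r)/andP[mU UM].
  by rewrite /ball/= distrC ger0_norm ?subr_ge0//; lra.
exists (fun j => lim (U t r j @[t --> +oo])) => i j.
apply/cvgrPdist_lt => e /(small j)[k [m [M [Mm mUM]]]].
have ml : m <= lim (U t r j @[t --> +oo]).
  by apply: limr_ge => //; apply: filterS (ev k) => t /(mUM r)/andP[].
have lM : lim (U t r j @[t --> +oo]) <= M.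
  by apply: limr_le => //; apply: filterS (ev k) => t /(mUM r)/andP[].
apply: filterS (ev k) => t /(mUM i)/andP[mU UM].
by rewrite ltr_norml; apply/andP; split; lra.
Qed.

(** * The semigroup generated by minus the Laplacian *)

Lemma laplacian_shift_ge0 (R : realType) (q : nat) (gamma : 'M[R]_q) (c : R)
    i j :
  (forall i j, 0 <= gamma i j) -> (forall i, \sum_k gamma i k <= c) ->
  0 <= (c%:M - laplacian gamma) i j.
Proof.
move=> g0 gc; rewrite !mxE; case: (eqVneq i j) => _.
  by rewrite mulr1n subr_ge0.
by rewrite mulr0n opprK add0r.
Qed.

(** The sum of row [i] equals [gamma i i], which is where the zero diagonal enters. *)
Lemma laplacian_const (R : realType) (q : nat) (gamma : 'M[R]_q) :
  (forall i, gamma i i = 0) ->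
  laplacian gamma *m const_mx 1 = 0 :> 'cV[R]_q.
Proof.
move=> gii; apply/matrixP => i j; rewrite !mxE (bigD1 i)//= !mxE eqxx mulr1.
rewrite [X in X + _](bigD1 i)//= gii add0r -big_split/= big1// => k ki.
by rewrite !mxE eq_sym (negbTE ki) mulr1 addrN.
Qed.

Lemma cvg_expm_laplacian (R : realType) (q : nat) (gamma : 'M[R]_q) :
  (forall i j, 0 <= gamma i j) -> (forall i, gamma i i = 0) ->
  has_spanning_tree (edge gamma) ->
  exists l : 'I_q -> R, forall i j,
    expm (t *: - laplacian gamma) i j @[t --> +oo] --> l j.
Proof.
move=> g0 gii [E [r [sE [rE _]]]].
(* The total weight bounds every row sum, which makes [N] nonnegative. *)
pose c := \sum_i \sum_k gamma i k.
pose N := c%:M - laplacian gamma.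
have N0 i j : 0 <= N i j.
  apply: laplacian_shift_ge0 => // k; rewrite /c [leRHS](bigD1 k)//= lerDl.
  by apply: sumr_ge0 => *; apply: sumr_ge0.
have UE t : 0 <= t ->
    expm (t *: - laplacian gamma) = expR (t * - c) *: expm (t *: N).
  by move=> t0; rewrite -expm_shift// /N addrAC addrN add0r.
have U1r i : 0 < expm (1 *: - laplacian gamma) i r.
  rewrite UE// mxE mulr_gt0 ?expR_gt0// scale1r.
  have [j i' /sE eji| |k Nk] := @mxexpr_path_gt0 _ _ N E r i N0.
  (* A tree edge is not a loop, so its entry in [N] is off-diagonal and equals the positive
     weight. *)
  - rewrite !mxE; case: (eqVneq i' j) => [ij|_]; last first.
      by rewrite mulr0n add0r opprK.
    by move: eji; rewrite ij /edge gii ltxx.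
  - exact: rE.
  - apply: lt_le_trans (ler_expm_coord k i r N0).
    by rewrite mulr_gt0// invr_gt0 ltr0n fact_gt0.
(* The contraction constant is the least entry of the root column at time 1; the default 1 of the
   minimum keeps it positive. *)
apply: (@stochastic_semigroup_cvg _ _ (fun t => expm (t *: - laplacian gamma)) r
  (\big[Num.min/1]_i expm (1 *: - laplacian gamma) i r)).
- move=> t i j t0; rewrite UE// mxE mulr_ge0 ?expR_ge0// expm_ge0// => i' j'.
  by rewrite mxE mulr_ge0.
- move=> t t0.
  (* The constant vector is a stationary solution, so the exponentials have unit row sums. *)
  have H := @linear_ode _ _ _ (- laplacian gamma) (fun=> const_mx 1 : 'cV[R]_q).
  apply/esym/H => // s; rewrite mulNmx laplacian_const// oppr0.
  exact: is_derive_mx_cst.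
- by move=> s t s0 _; exact: expmD.
- by rewrite scale0r expm0.
- by apply/bigmin_gtP; split.
- by move=> i; exact: bigmin_le.
Qed.

(** * Stacked states and the limiting jump matrix *)

Lemma unit_state_tensmx (R : realType) (q n : nat) (C : 'M[R]_q) (D : 'M[R]_n)
    (y : 'cV[R]_(q * n)) i :
  unit_state ((C *t D) *m y) i = \sum_l C i l *: (D *m unit_state y l).
Proof.
apply/matrixP => k o; rewrite mxE summxE mxE.
rewrite (reindex (@mxtens_index q n)) /=; last first.
  exists (@mxtens_unindex q n) => p _; first exact: mxtens_indexK.
  exact: mxtens_unindexK.
transitivity (\sum_l \sum_m (C *t D) (mxtens_index (i, k))
    (mxtens_index (l, m)) * y (mxtens_index (l, m)) ord0).
  by rewrite pair_bigA; apply: eq_bigr => -[].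
apply: eq_bigr => l _; rewrite !mxE mulr_sumr; apply: eq_bigr => m _.
by rewrite tensmxE !mxE mulrA.
Qed.

Lemma unit_state_tens1mx (R : realType) (q n : nat) (D : 'M[R]_n)
    (y : 'cV[R]_(q * n)) i :
  unit_state (((1%:M : 'M[R]_q) *t D) *m y) i = D *m unit_state y i.
Proof.
rewrite unit_state_tensmx (bigD1 i)//= mxE eqxx scale1r big1 ?addr0// => l li.
by rewrite mxE eq_sym (negbTE li) scale0r.
Qed.

Lemma unit_stateD (R : realType) (q n : nat) (x y : 'cV[R]_(q * n)) i :
  unit_state (x + y) i = unit_state x i + unit_state y i.
Proof. by apply/matrixP => k o; rewrite !mxE. Qed.

Lemma mulmx_col_row_idem (R : realType) (n : nat) (B : 'cV[R]_n) (K : 'rV[R]_n)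
    (E : 'M[R]_n) :
  E \in unitmx -> ((1%:M - B *m K) *m E) ^+ n = 0 ->
  (B *m K) *m (B *m K) = B *m K.
Proof.
(* Dimension 0 is separate: only in positive dimension is the matrix ring nontrivial, so that a
   nilpotent matrix is not a unit. *)
case: n B K E => [|n] B K E Eu nil; first by rewrite [RHS]flatmx0 [LHS]flatmx0.
have : \det (1%:M - B *m K) = 0.
  have : (1%:M - B *m K) *m E \notin unitmx.
    apply/negP => u; have := @unitrX 'M[R]_n.+1 _ n.+1 u.
    by rewrite nil unitr0.
  by rewrite unitmx_mul Eu andbT unitmxE unitfE negbK => /eqP.
(* A left null vector satisfies [v = s *: K] with [s = v *m B], and [s] is nonzero because [v] is.
   Multiplying by [B] gives [s = s * (K *m B)], hence [K *m B = 1]. *)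
move=> /eqP/det0P[v v0]; rewrite mulmxBr mulmx1 => /eqP; rewrite subr_eq0.
move=> /eqP vE.
rewrite mulmxA in vE.
pose s := (v *m B) 0 0.
have vBs : v *m B = s%:M by rewrite [LHS]mx11_scalar.
have s0 : s != 0.
  apply: contra v0 => s0.
  by rewrite vE vBs (eqP s0) mul_scalar_mx scale0r.
suff KB : K *m B = 1%:M by rewrite mulmxA -(mulmxA B) KB mulmx1.
apply: (scalerI s0); rewrite scalemxAl -mul_scalar_mx -vBs -vE vBs.
by rewrite scalemx1.
Qed.

(** As a function of [mu], the right-hand side is the identity at 0 and solves the equation defining
    the jump, because [P] is idempotent and annihilates [1 - P]. *)
Lemma jumpE (R : realType) (q n : nat) (gamma : 'M[R]_q) (B : 'cV[R]_n)
    (K : 'rV[R]_n) (mu : R) :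
  (B *m K) *m (B *m K) = B *m K -> 0 <= mu ->
  jump gamma B K mu = 1%:M *t (1%:M - B *m K) +
    expm (mu *: - laplacian gamma) *t (B *m K).
Proof.
move=> PP mu0; set P := B *m K; set G := laplacian gamma.
pose z s := (1%:M : 'M[R]_q) *t (1%:M - P) + expm (s *: - G) *t P.
have tP (C C' : 'M[R]_q) (D D' : 'M[R]_n) :
    (C *t D) *m (C' *t D') = (C *m C') *t (D *m D') by exact: tensmx_mul.
have := @linear_ode _ _ _ (- (G *t P)) z _ mu mu0.
have -> : z 0 = 1%:M.
  rewrite /z scale0r expm0; apply/matrixP => a b.
  case: (mxtens_indexP a) => i k; case: (mxtens_indexP b) => j l.
  rewrite mxE !tensmxE -mulrDr !mxE subrK -natrM mulnb -xpair_eqE.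
  by rewrite (can_eq (@mxtens_indexK q n)).
rewrite mulmx1 scalerN /jump => H.
apply/esym/H => s {H}.
apply/is_derive_mxP => a b.
case: (mxtens_indexP a) => i k; case: (mxtens_indexP b) => j l.
under eq_fun do rewrite mxE !tensmxE.
have /is_derive_mxP /(_ i j) dE := is_derive_expm (- G) s.
have [dP DP] := @is_deriveD _ _ _ _ _ s 1 _ _ (is_derive_cst
   ((1%:M : 'M[R]_q) i j * (1%:M - P) k l) s 1)
  (@is_deriveM _ _ _ _ _ _ _ _ dE (is_derive_cst (P k l) s 1)).
apply: DeriveDef; first exact: dP.
have PQ : P *m (1%:M - P) = 0 by rewrite mulmxBr mulmx1 PP subrr.
rewrite [LHS]DP /z mulmxDr !mulNmx !tP PQ PP tensmx0 oppr0 !add0r.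
by rewrite scaler0 add0r !mxE !mxtens_indexK /= scalerN /GRing.scale/= mulrC.
Qed.

Lemma cvg_unit_state (R : realType) (q n : nat) (I : Type) (F : set_system I)
    (f : I -> 'cV[R]_(q * n)) (L : 'cV[R]_(q * n)) i {FF : Filter F} :
  f x @[x --> F] --> L ->
  unit_state (f x) i @[x --> F] --> unit_state L i.
Proof.
move=> /cvg_mxP fL; apply/cvg_mxP => k o; rewrite mxE.
under eq_fun do rewrite mxE; exact: fL.
Qed.

Lemma is_derive_unit_state (R : realType) (q n : nat)
    (x : R -> 'cV[R]_(q * n)) (t : R) (D : 'cV[R]_(q * n)) i :
  is_derive t 1 x D ->
  is_derive t 1 (fun s => unit_state (x s) i) (unit_state D i).
Proof.
move=> /is_derive_mxP xD; apply/is_derive_mxP => k o; rewrite mxE.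
under eq_fun do rewrite mxE; exact: xD.
Qed.

(** A solution is unconstrained at negative times, so its right continuity at 0 has to come from the
    one-sided difference quotient. *)
Lemma cvg_right_derive (R : realType) (m n : nat) (x : R -> 'M[R]_(m, n))
    (D : 'M[R]_(m, n)) :
  h^-1 *: (x h - x 0) @[h --> 0^'+] --> D -> x h @[h --> 0^'+] --> x 0.
Proof.
move=> xD.
have h0 : (h : R) @[h --> 0^'+] --> (0 : R).
  by apply: cvg_within_filter; exact: cvg_id.
have : h *: (h^-1 *: (x h - x 0)) + x 0 @[h --> 0^'+] --> 0 *: D + x 0.
  by apply: cvgD; [exact: cvgZ|exact: cvg_cst].
rewrite scale0r add0r; apply: cvg_trans; apply: near_eq_cvg; near=> h.
have hn0 : h != 0 by rewrite gt_eqF//; near: h; exact: nbhs_right_gt.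
by rewrite scalerA divff// scale1r subrK.
Unshelve. all: by end_near. Qed.

Lemma cvg_jump (R : realType) (q n : nat) (gamma : 'M[R]_q) (B : 'cV[R]_n)
    (K : 'rV[R]_n) (l : 'I_q -> R) :
  (B *m K) *m (B *m K) = B *m K ->
  (forall i j, expm (t *: - laplacian gamma) i j @[t --> +oo] --> l j) ->
  jump gamma B K mu @[mu --> +oo] -->
    1%:M *t (1%:M - B *m K) + (\matrix_(i, j) l j) *t (B *m K).
Proof.
move=> PP gl.
have : (1%:M : 'M[R]_q) *t (1%:M - B *m K) +
      expm (mu *: - laplacian gamma) *t (B *m K) @[mu --> +oo] -->
    1%:M *t (1%:M - B *m K) + (\matrix_(i, j) l j) *t (B *m K).
  apply: cvgD; first exact: cvg_cst.
  apply/cvg_mxP => a b.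
  case: (mxtens_indexP a) => i k; case: (mxtens_indexP b) => j m.
  rewrite tensmxE mxE; under eq_fun do rewrite tensmxE.
  by apply: cvgM; [exact: gl|exact: cvg_cst].
apply: cvg_trans; apply: near_eq_cvg.
(* The closed form of the jump is available for nonnegative [mu] only, which holds eventually. *)
have ev : \forall mu \near +oo, (0 : R) <= mu.
  by apply: nbhs_pinfty_ge; exact: num_real.
by apply: filterS ev => mu mu0; rewrite jumpE.
Qed.

Lemma unit_state_jumpB (R : realType) (q n : nat) (P : 'M[R]_n) (l : 'I_q -> R)
    (y : 'cV[R]_(q * n)) i j :
  let J := (1%:M : 'M[R]_q) *t (1%:M - P) + (\matrix_(i, j) l j) *t P in
  unit_state (J *m y) i - unit_state (J *m y) j =
  (1%:M - P) *m (unit_state y i - unit_state y j).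
Proof.
rewrite /= ![in LHS]mulmxDl !unit_stateD !unit_state_tens1mx.
rewrite !unit_state_tensmx [RHS]mulmxBr opprD addrACA.
rewrite [X in _ + X](_ : _ = 0) ?addr0//.
(* The rows of the limit matrix agree, so both units receive the same weighted sum. *)
apply/eqP; rewrite subr_eq0; apply/eqP; apply: eq_bigr => k _.
by rewrite !mxE.
Qed.

(** * Flow over one period between impulses *)

Lemma impulsive_linear_step (R : realType) (n m : nat) (A : 'M[R]_n) (T : R)
    (z : R -> 'M[R]_(n, m)) (k : nat) :
  0 < T ->
  (forall t : R, 0 < t -> (forall k : nat, (0 < k)%N -> t != k%:R * T) ->
    is_derive t 1 z (A *m z t)) ->
  z t @[t --> (k%:R * T)^'+] --> z (k%:R * T) ->
  forall t, k%:R * T <= t < k.+1%:R * T ->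
    z t = expm ((t - k%:R * T) *: A) *m z (k%:R * T).
Proof.
move=> T0 dz zr t /andP[]; rewrite le_eqVlt => /predU1P[<- _|kt tk].
  by rewrite subrr scale0r expm0 mul1mx.
have dz' (s : R) : k%:R * T < s < k.+1%:R * T -> is_derive s 1 z (A *m z s).
  move=> /andP[ks sk]; apply: dz => [|k' _].
    by apply: le_lt_trans ks; rewrite mulr_ge0// ltW.
  (* No integer lies strictly between [k] and [k.+1], so the open period contains no impulse
     time. *)
  apply/eqP => sE; move: ks sk; rewrite sE !ltr_pM2r// !ltr_nat ltnS.
  by move=> /leq_trans h /h; rewrite ltnn.
apply: linear_ode_itv => //; first exact: ltW.
- move=> s /andP[ks st]; apply: dz'; rewrite ks; exact: lt_trans st tk.
- apply: cvg_within_filter; apply: is_derive_mx_cvg; apply: dz'.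
  by rewrite kt.
Qed.

(** The state just before the next impulse is the continuous extension of the flow to elapsed time
    [T]. *)
Lemma impulsive_linear_left_limit (R : realType) (n m : nat) (A : 'M[R]_n)
    (T : R) (z : R -> 'M[R]_(n, m)) (zm : 'M[R]_(n, m)) (k : nat) :
  0 < T ->
  (forall t, k%:R * T <= t < k.+1%:R * T ->
    z t = expm ((t - k%:R * T) *: A) *m z (k%:R * T)) ->
  z t @[t --> (k.+1%:R * T)^'-] --> zm ->
  zm = expm (T *: A) *m z (k%:R * T).
Proof.
move=> T0 zE zl; apply: (cvg_unique _ zl); first exact: norm_hausdorff.
set a := k%:R * T; set b := k.+1%:R * T.
have ab : a < b by rewrite ltr_pM2r// ltr_nat.
have Eb : expm ((t - a) *: A) @[t --> b^'-] --> expm (T *: A).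
  have -> : T = b - a by rewrite -mulrBl -natrB// subSnn mul1r.
  apply: cvg_within_filter.
  have ca : (t - a) @[t --> b] --> b - a.
    by apply: cvgB; [exact: cvg_id|exact: cvg_cst].
  exact: (cvg_comp _ _ ca (is_derive_mx_cvg (is_derive_expm A (b - a)))).
have : expm ((t - a) *: A) *m z a @[t --> b^'-] --> expm (T *: A) *m z a.
  by apply: cvg_mulmx => //; exact: cvg_cst.
apply: cvg_trans; apply: near_eq_cvg; near=> t.
rewrite [z t]zE//; apply/andP; split.
- by near: t; exact: nbhs_left_ge.
- by near: t; exact: nbhs_left_lt.
Unshelve. all: by end_near. Qed.

(** * Vanishing of the disagreement after [n] periods *)

Theorem theorem2 (R : realType) (q n : nat) (A : 'M[R]_n) (B : 'cV[R]_n)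
    (K : 'rV[R]_n) (T : R) (gamma : 'M[R]_q) :
  (2 <= q)%N ->
  0 < T ->
  (forall i j, 0 <= gamma i j) ->
  (forall i, gamma i i = 0) ->
  controllable A B ->
  controllable (expm (T *: A)) B ->
  has_spanning_tree (edge gamma) ->
  ((1%:M - B *m K) *m expm (T *: A)) ^+ n = 0 ->
  cvg (jump gamma B K mu @[mu --> +oo]) /\
  forall x : R -> 'cV[R]_(q * n),
    impulsive_solution A T (jump_infty gamma B K) x ->
    forall (i j : 'I_q) (t : R), n%:R * T < t ->
      unit_state (x t) i = unit_state (x t) j.
Proof.
move=> _ T0 g0 gii _ _ tree nil.
have PP := mulmx_col_row_idem (expm_unitmx _) nil.
have [l gl] := cvg_expm_laplacian g0 gii tree.
have cJ := cvg_jump PP gl.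
(* Convergence is part of the claim: it makes [jump_infty] a genuine limit rather than a default
   value of [lim]. *)
split; first by apply/cvg_ex; eexists; exact: cJ.
have JE : jump_infty gamma B K =
    1%:M *t (1%:M - B *m K) + (\matrix_(i, j) l j) *t (B *m K).
  by apply/cvg_lim; first exact: norm_hausdorff.
move=> x [x0 dx jx] i j t nt; apply/eqP; rewrite -subr_eq0; apply/eqP.
pose z s := unit_state (x s) i - unit_state (x s) j.
have dz (s : R) : 0 < s -> (forall k : nat, (0 < k)%N -> s != k%:R * T) ->
    is_derive s 1 z (A *m z s).
  move=> s0 sk; have dxs := dx s s0 sk.
  rewrite mulmxBr -!unit_state_tens1mx.
  by apply: is_deriveB; exact: is_derive_unit_state.
(* At 0 right continuity comes from the one-sided derivative, at impulse times from the jump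
   condition. *)
have zr k : z s @[s --> (k%:R * T)^'+] --> z (k%:R * T).
  suff xr : x s @[s --> (k%:R * T)^'+] --> x (k%:R * T).
    by apply: cvgB; exact: cvg_unit_state.
  case: k => [|k]; first by rewrite mul0r; exact: cvg_right_derive x0.
  by have [xm [_ xr ->]] := jx k.+1 isT.
have flow k := impulsive_linear_step T0 dz (zr k).
have zS k : z (k.+1%:R * T) =
    (1%:M - B *m K) *m expm (T *: A) *m z (k%:R * T).
  have [xm [xl _ xk]] := jx k.+1 isT.
  rewrite /z xk JE unit_state_jumpB -mulmxA; congr (_ *m _).
  apply: (impulsive_linear_left_limit T0 (flow k)).
  by apply: cvgB; exact: cvg_unit_state.
have zX k : z (k%:R * T) =
    ((1%:M - B *m K) *m expm (T *: A)) ^+ k *m z 0.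
  elim: k => [|k IH]; first by rewrite mul0r expr0 mul1mx.
  by rewrite zS IH mulmxA mxexprS.
have z0 k : (n <= k)%N -> z (k%:R * T) = 0.
  by move=> /subnK <-; rewrite zX exprD nil mulr0 mul0mx.
have tT0 : 0 <= t / T.
  by rewrite divr_ge0 ?(ltW T0)// ltW// (le_lt_trans _ nt)// mulr_ge0// ltW.
(* With [k] the integer part of [t / T], the bounds [n * T < t < k.+1 * T] give [n <= k]; the
   disagreement is 0 at [k * T] and the flow keeps it 0 up to [t]. *)
have := truncn_itv tT0; set k := Num.truncn _.
rewrite ler_pdivlMr// ltr_pdivrMr// => /andP[kt tk].
rewrite -/(z t) (flow k) ?kt// z0 ?mulmx0//.
by rewrite -ltnS -(ltr_nat R) -(ltr_pM2r T0); exact: lt_trans nt tk.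
Qed.
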